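(* Let $\{Y^f_\mu(t)\}_{t\ge0}$, $Y^f_\mu(t)=Y^f(G_\mu(t))$, be the geometric subordinated compound Poisson process. Let $\chi_0=0$ and let $\chi_1,\chi_2,\dots$ be i.i.d. random variables distributed as $Y^f(1)$, independent of $\{G_\mu(t)\}_{t\ge 0}$. Then for every $t\ge0$, $$Y^f_\mu(t)\stackrel{d}{=}\sum_{i=0}^{G_\mu(t)}\chi_i,$$ where $\stackrel{d}{=}$ denotes equality in distribution.
   Context: $\{D^f(t)\}_{t\ge0}$ is a Lévy subordinator (non-decreasing Lévy process) with Laplace transform $\mathbb{E}[e^{-sD^f(t)}]=e^{-tf(s)}$, where $f(s)=bs+\int_0^\infty(1-e^{-sx})\,\nu(dx)$, $b\ge0$, is a Bernstein function, and $\nu$ is a Lévy measure on the positive half-line with $\int_0^\infty (x\wedge 1)\,\nu(dx)<\infty$ and infinite total mass. $\{N(t)\}_{t\ge0}$ is a homogeneous Poisson process with intensity $\lambda>0$, independent of $D^f$, and $N^f(t)=N(D^f(t))$ is the subordinated Poisson process. $X_1,X_2,\dots$ are i.i.d. random variables (jumps) with common distribution function $F_X$, independent of $N^f$. The generalized compound Poisson process is $Y^f(t)=\sum_{i=1}^{N^f(t)}X_i$ (empty sum $=0$). The geometric counting process $\{G_\mu(t)\}_{t\ge0}$ with parameter $\mu>0$ is the mixed Poisson process whose random rate is exponentially distributed with mean $\mu$, so $\mathbb{P}[G_\mu(t)=k]=\frac{1}{1+\mu t}\left(\frac{\mu t}{1+\mu t}\right)^k$, $k=0,1,2,\dots$.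 The geometric subordinated compound Poisson process is $Y^f_\mu(t)=Y^f(G_\mu(t))$ with $G_\mu$ independent of $Y^f$. *)

(* Defs.v *)
From HB Require Import structures.
From mathcomp Require Export all_boot all_order all_algebra.
From mathcomp Require Export all_classical all_reals all_analysis.

Set Implicit Arguments.
Unset Strict Implicit.
Unset Printing Implicit Defensive.

Export Order.TTheory GRing.Theory Num.Theory.
Export numFieldNormedType.Exports.

Local Open Scope classical_set_scope.
Local Open Scope ring_scope.

Section probability_notions.
Context (d : measure_display) (T : measurableType d) (R : realType).
Variable P : probability T R.

Section general_codomain.
Context (d' : measure_display) (E : measurableType d').

(* Measurability is part of the relation: [P] is meaningless on
   non-measurable sets, so the bare equality would say nothing about
   non-measurable maps. *)
Definition equal_in_distribution (X Y : T -> E) : Prop :=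
  [/\ measurable_fun [set: T] X, measurable_fun [set: T] Y
    & forall A : set E, measurable A -> P (X @^-1` A) = P (Y @^-1` A)].

Definition mutually_independent (I : set nat) (X : nat -> T -> E) : Prop :=
  forall (J : seq nat) (B : nat -> set E),
    uniq J -> (forall i, i \in J -> I i) -> (forall i, measurable (B i)) ->
    P (\bigcap_(i in [set` J]) (X i @^-1` B i)) =
    (\prod_(i <- J) P (X i @^-1` B i))%E.

Definition iid (I : set nat) (X : nat -> T -> E) : Prop :=
  mutually_independent I X /\
  forall i j, I i -> I j -> equal_in_distribution (X i) (X j).

Definition process_sigma_algebra (K : Type) (I : set K) (X : K -> T -> E) :
    set (set T) :=
  <<s \bigcup_(i in I) preimage_set_system [set: T] (X i) measurable >>.

End general_codomain.

Definition independent_processes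
    (d1 d2 : measure_display) (E1 : measurableType d1) (E2 : measurableType d2)
    (K1 K2 : Type) (I1 : set K1) (I2 : set K2)
    (X : K1 -> T -> E1) (Y : K2 -> T -> E2) : Prop :=
  forall A B : set T,
    process_sigma_algebra I1 X A -> process_sigma_algebra I2 Y B ->
    P (A `&` B) = (P A * P B)%E.

(* In the next two definitions a finite sequence of times is extended by
   constancy; mutual independence only involves finite subfamilies. *)

Record levy_process (D : R -> T -> R) : Prop := {
  levy_start : forall w, D 0 w = 0 ;
  levy_independent_increments : forall t : nat -> R,
    0 <= t 0%N -> nondecreasing_seq t ->
    mutually_independent [set: nat] (fun i w => D (t i.+1) w - D (t i) w) ;
  levy_stationary_increments : forall s t : R, 0 <= s -> 0 <= t ->
    equal_in_distribution (fun w => D (s + t) w - D s w) (D t) ;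
  levy_right_continuous : forall w (t : R), 0 <= t ->
    D s w @[s --> t^'+] --> D t w ;
  levy_left_limits : forall w (t : R), 0 < t ->
    cvg (D s w @[s --> t^'-]) }.

Definition subordinator (D : R -> T -> R) : Prop :=
  levy_process D /\
  forall w (s t : R), 0 <= s -> s <= t -> D s w <= D t w.

Record counting_process (N : R -> T -> nat) : Prop := {
  counting_start : forall w, N 0 w = 0%N ;
  counting_nondecreasing : forall w (s t : R), 0 <= s -> s <= t ->
    (N s w <= N t w)%N ;
  counting_right_continuous : forall w (t : R), 0 <= t ->
    N s w @[s --> t^'+] --> N t w }.

(* [poisson_prob r _] is the Poisson distribution of parameter [r] (the Dirac
   measure at 0 when [r = 0]); the library ignores its second argument.
   [poisson_pmf r] is not used since it is constantly 1 when [r = 0]. *)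

Definition poisson_process (lambda : R) (N : R -> T -> nat) : Prop :=
  [/\ counting_process N,
      forall t : nat -> R, 0 <= t 0%N -> nondecreasing_seq t ->
        mutually_independent [set: nat]
          (fun i w => (N (t i.+1) w - N (t i) w)%N)
    & forall (s t : R) (k : nat), 0 <= s -> s <= t ->
        P [set w | (N t w - N s w)%N = k] =
        poisson_prob (lambda * (t - s)) 0%N [set k]].

(* The mixed Poisson process with random rate of law [U]: its distribution is
   the [U]-mixture of the distributions of Poisson processes of rate [x]. *)
Definition mixed_poisson_process (U : set R -> \bar R) (N : R -> T -> nat) :
    Prop :=
  counting_process N /\
  forall (n : nat) (t : nat -> R) (k : nat -> nat),
    0 <= t 0%N -> nondecreasing_seq t ->
    P [set w | forall i, (i < n)%N -> (N (t i.+1) w - N (t i) w)%N = k i] =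
    (\int[U]_x \prod_(i < n)
       poisson_prob (x * (t i.+1 - t i)) 0%N [set k i])%E.

(* The library's exponential distribution is parametrised by its rate, that is
   by the inverse of the mean [mu]. *)
Definition geometric_counting_process (mu : R) (G : R -> T -> nat) : Prop :=
  mixed_poisson_process (exponential_prob mu^-1) G.

End probability_notions.

Section levy_exponent.
Context (R : realType).

(* [nu] is a Levy measure of infinite total mass on the positive half-line,
   seen as a measure on the real line. *)
Definition infinite_levy_measure (nu : {measure set R -> \bar R}) : Prop :=
  [/\ nu [set x : R | x <= 0] = 0%E,
      (\int[nu]_(x in [set x : R | (0 < x)%R]) (Num.min x 1)%:E < +oo)%E
    & nu [set x : R | 0 < x] = +oo%E].

Definition bernstein_levy_khintchine (b : R) (nu : {measure set R -> \bar R})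
    (f : R -> R) : Prop :=
  forall s : R, 0 <= s ->
    (f s)%:E =
    ((b * s)%:E +
     \int[nu]_(x in [set x : R | (0 < x)%R]) (1 - expR (- s * x))%:E)%E.

End levy_exponent.

Definition subordinated (T : Type) (R : realType)
    (N : R -> T -> nat) (D : R -> T -> R) (t : R) (w : T) : nat :=
  N (D t w) w.

Definition compound (T : Type) (R : realType)
    (M : R -> T -> nat) (X : nat -> T -> R) (t : R) (w : T) : R :=
  \sum_(1 <= i < (M t w).+1) X i w.

Definition time_change (T : Type) (R : realType)
    (Y : R -> T -> R) (G : R -> T -> nat) (t : R) (w : T) : R :=
  Y (G t w)%:R w.

(* Main.v *)
From HB Require Import structures.
Require Import Defs.
From mathcomp Require Import measurable_realfun ring.

Set Implicit Arguments.
Unset Strict Implicit.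
Unset Printing Implicit Defensive.

Local Open Scope classical_set_scope.
Local Open Scope ring_scope.

(* Conditioning on [G t = n] reduces the claim to the equality in law of
   Y^f(n) and chi_1 + ... + chi_n for a deterministic n, that is, by induction
   on n, to the identity law Y^f(n+1) = law Y^f(n) * law Y^f(1) (convolution).
   The law of Y^f(n) is the mixture of the laws of X_1 + ... + X_k with weights
   P(N^f(n) = k), so it suffices that these weights convolve.  Conditioning on
   D^f gives P(N^f(n) = k) = E[pois_k(lambda D^f(n))], and the weights convolve
   because the Poisson distributions do and because D^f has independent
   stationary increments.  Laws are compared through the integrals of
   nonnegative measurable functions. *)

(** * Independence, laws and countable partitions as identities between integrals *)

Section independence.
Context (d : measure_display) (T : measurableType d) (R : realType).
Variable P : probability T R.
Local Open Scope ereal_scope.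

(** Uniqueness of finite measures: [P (A ∩ C)] and [P A * P C] are both measures in [A], and they
    agree on a pi-system containing the whole space. *)
Lemma independent_g_sigma (G : set (set T)) (C : set T) :
  G `<=` measurable -> setI_closed G -> G setT -> measurable C ->
  (forall A, G A -> P (A `&` C) = P A * P C) ->
  forall A, <<s G >> A -> P (A `&` C) = P A * P C.
Proof.
move=> mG GI GT mC indG A GA.
have PC0 : (0 <= fine (P C))%R by exact: fine_ge0.
pose m1 := mrestr P mC.
pose m2 := mscale (NngNum PC0) P.
have m2E B : m2 B = P B * P C.
  by rewrite /m2 /mscale/= fineK ?fin_num_measure// muleC.
rewrite -m2E -[LHS]/(m1 A).
apply: (@g_sigma_algebra_measure_unique _ _ _ G mG (fun=> setT)) => //.
- by apply/seteqP; split => // x _; exists 0%N.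
- by move=> B GB; rewrite [LHS]indG// [RHS]m2E.
- by move=> _; rewrite /= /m1 /mrestr setTI (le_lt_trans (probability_le1 P mC))// ltry.
Qed.

Lemma integral_probability_cst (c : \bar R) : \int[P]_w c = c.
Proof.
have := @integral_cst _ _ _ P setT measurableT c.
rewrite /= => ->; rewrite -[RHS]mule1; congr (_ * _).
exact: probability_setT.
Qed.

(** The joint law is the product of the two laws, so Tonelli applies. Here [v] plays the role of an
    independent copy of the sample point; convolutions of laws are written in this form
    throughout. *)
Lemma integral_independent_pair d1 d2 (E1 : measurableType d1)
    (E2 : measurableType d2) (U : T -> E1) (V : T -> E2) :
  measurable_fun setT U -> measurable_fun setT V ->
  (forall A B, measurable A -> measurable B ->
     P (U @^-1` A `&` V @^-1` B) = P (U @^-1` A) * P (V @^-1` B)) ->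
  forall h : E1 * E2 -> \bar R, measurable_fun setT h -> (forall z, 0 <= h z) ->
  \int[P]_w h (U w, V w) = \int[P]_v \int[P]_w h (U w, V v).
Proof.
move=> mU mV indUV h mh h0.
pose U' : {RV P >-> E1} := HB.pack U (isMeasurableFun.Build _ _ _ _ _ mU).
pose V' : {RV P >-> E2} := HB.pack V (isMeasurableFun.Build _ _ _ _ _ mV).
have mUV : measurable_fun setT (fun w => (U w, V w)) by exact: measurable_fun_pair.
pose W' : {RV P >-> (E1 * E2)%type} :=
  HB.pack (fun w => (U w, V w)) (isMeasurableFun.Build _ _ _ _ _ mUV).
transitivity (\int[distribution P W']_z h z).
  by rewrite ge0_integral_distribution.
transitivity (\int[(distribution P U' \x distribution P V')]_z h z).
  apply: eq_measure_integral => /= A mA _; apply/esym.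
  by apply: product_measure_unique => // B C mB mC; exact: indUV.
rewrite fubini_tonelli2//.
rewrite ge0_integral_distribution//; first last.
- by move=> y; apply: integral_ge0.
- exact: measurable_fun_fubini_tonelli_G.
apply: eq_integral => v _ /=; rewrite /fubini_G.
rewrite ge0_integral_distribution//.
exact: measurableT_comp.
Qed.

Lemma integral_equal_in_distribution d1 (E : measurableType d1) (U V : T -> E) :
  equal_in_distribution P U V ->
  forall h : E -> \bar R, measurable_fun setT h -> (forall z, 0 <= h z) ->
  \int[P]_w h (U w) = \int[P]_w h (V w).
Proof.
case=> mU mV UV h mh h0.
pose U' : {RV P >-> E} := HB.pack U (isMeasurableFun.Build _ _ _ _ _ mU).
pose V' : {RV P >-> E} := HB.pack V (isMeasurableFun.Build _ _ _ _ _ mV).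
transitivity (\int[distribution P U']_z h z).
  by rewrite ge0_integral_distribution.
transitivity (\int[distribution P V']_z h z).
  by apply: eq_measure_integral => /= A mA _; exact: UV.
by rewrite ge0_integral_distribution.
Qed.

Lemma probability_partition_nat (K : T -> nat) (A : set T) :
  measurable_fun setT K -> measurable A ->
  P A = \sum_(k <oo) P (K @^-1` [set k] `&` A).
Proof.
move=> mK mA.
have mF k : measurable (K @^-1` [set k] `&` A).
  by apply: measurableI => //; rewrite -[X in measurable X]setTI; exact: mK.
have AE : A = \bigcup_k (K @^-1` [set k] `&` A).
  apply/seteqP; split => [x Ax|x [k _ []]//].
  by exists (K x).
rewrite [in LHS]AE measure_bigcup//=; last first.
  apply/trivIsetP => i j _ _ ij.
  by apply/seteqP; split => // x [[/= Ki _] [/= Kj _]]; rewrite -Ki -Kj eqxx in ij.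
by apply: eq_eseriesl => k; rewrite in_setT.
Qed.

Lemma integral_partition_nat (K : T -> nat) (h : T -> \bar R) :
  measurable_fun setT K -> measurable_fun setT h -> (forall w, 0 <= h w) ->
  \int[P]_w h w = \sum_(k <oo) \int[P]_(w in K @^-1` [set k]) h w.
Proof.
move=> mK mh h0.
have UK : \bigcup_k (K @^-1` [set k]) = setT.
  by apply/seteqP; split => // x _; exists (K x).
rewrite -{1}UK ge0_integral_bigcup//=.
- by move=> k; rewrite -[X in measurable X]setTI; exact: mK.
- by rewrite UK.
- apply/trivIsetP => i j _ _ ij.
  by apply/seteqP; split => // x [/= Ki Kj]; rewrite -Ki -Kj eqxx in ij.
Qed.

End independence.

(** * Partial sums of independent and of i.i.d. sequences *)

Section partial_sums.
Context (d : measure_display) (T : measurableType d) (R : realType).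
Variable P : probability T R.
Implicit Types X : nat -> T -> R.
Local Open Scope ereal_scope.

Definition partial_sum X (k : nat) (w : T) : R := (\sum_(1 <= i < k.+1) X i w)%R.

Lemma partial_sum0 X w : partial_sum X 0 w = 0%R.
Proof. by rewrite /partial_sum big_geq. Qed.

Lemma partial_sumS X k w : partial_sum X k.+1 w = (partial_sum X k w + X k.+1 w)%R.
Proof. by rewrite /partial_sum big_nat_recr. Qed.

(** The generating family is left arbitrary because three are used: all measurable sets, the
    cylinders over the first [k] variables, and the generators of a process sigma-algebra. *)
Lemma g_sigma_partial_sum (G : set (set T)) X k :
  (forall i, (1 <= i <= k)%N -> forall B, measurable B -> <<s G >> (X i @^-1` B)) ->
  forall B, measurable B -> <<s G >> (partial_sum X k @^-1` B).
Proof.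
move=> GX B mB.
(* The sample space is re-equipped with the sigma-algebra generated by [G], for which every summand
   is measurable by assumption. *)
have mS : measurable_fun (setT : set (g_sigma_algebraType G))
    (fun w => \sum_(i < k) X i.+1 w)%R.
  apply: measurable_sum => -[i ik] _ C mC; rewrite setTI.
  by apply: GX => //=; rewrite ltnS.
have := mS measurableT B mB; rewrite setTI.
congr (_ _); apply/seteqP; split => w /=;
  by rewrite /partial_sum big_add1 big_mkord.
Qed.

Lemma measurable_partial_sum X k : (forall i, measurable_fun setT (X i)) ->
  measurable_fun setT (partial_sum X k).
Proof.
move=> mX _ B mB; rewrite setTI.
rewrite -(@sigma_algebra_id _ setT measurable); last exact: sigma_algebra_measurable.
apply: g_sigma_partial_sum => // i _ C mC; apply: sub_sigma_algebra.
by rewrite -[X in measurable X]setTI; exact: mX.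
Qed.

(** Mutual independence separates [X k.+1] from each cylinder over [X 1], ..., [X k]. These
    cylinders form a pi-system, and the sigma-algebra they generate contains the events of the
    partial sum. *)
Lemma independent_partial_sum X k : (forall i, measurable_fun setT (X i)) ->
  mutually_independent P [set i | (1 <= i)%N] X ->
  forall A B, measurable A -> measurable B ->
  P (partial_sum X k @^-1` A `&` X k.+1 @^-1` B) =
  P (partial_sum X k @^-1` A) * P (X k.+1 @^-1` B).
Proof.
move=> mX indX A B mA mB.
have mXB i C : measurable C -> measurable (X i @^-1` C).
  by move=> mC; rewrite -[X in measurable X]setTI; exact: mX.
pose cyl (C : nat -> set R) := \bigcap_(i in [set` iota 1 k]) (X i @^-1` C i).
pose G := [set E | exists2 C : nat -> set R, (forall i, measurable (C i)) & E = cyl C].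
apply: (@independent_g_sigma _ _ _ _ G) => //.
- move=> _ [C mC ->]; apply: fin_bigcap_measurable => // i _.
  exact: mXB.
- move=> _ _ [C mC ->] [C' mC' ->].
  exists (fun i => C i `&` C' i); first by move=> i; exact: measurableI.
  by rewrite /cyl -bigcapI.
- by exists (fun=> setT) => //; apply/esym/seteqP; split.
- exact: mXB.
- move=> _ [C mC ->].
  have k1 i : i \in iota 1 k -> (i == k.+1) = false.
    by rewrite mem_iota add1n => /andP[_]; case: eqP => // ->; rewrite ltnn.
  (* A single family of sets carries both the cylinder and the event on [X k.+1], so that mutual
     independence applies to the index list [k.+1 :: iota 1 k]. *)
  pose C' i := if i == k.+1 then B else C i.
  have mC' i : measurable (C' i) by rewrite /C'; case: ifP.
  have kC : [set` k.+1 :: iota 1 k] = k.+1 |` [set` iota 1 k].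
    by apply/seteqP; split => i /=; rewrite in_cons => /predU1P.
  have CC' : cyl C' = cyl C.
    by apply: eq_bigcapr => i /k1 /= ik; rewrite /C' ik.
  have i1 i : i \in iota 1 k -> (1 <= i)%N by rewrite mem_iota => /andP[].
  have := indX (k.+1 :: iota 1 k) C'.
  rewrite /= iota_uniq andbT kC bigcap_setU1 big_cons -/(cyl C') CC'.
  have -> : C' k.+1 = B by rewrite /C' eqxx.
  rewrite setIC => -> //; last 2 first.
  + by apply/negP => /k1; rewrite eqxx.
  + by move=> i; rewrite in_cons => /predU1P[-> //|/i1].
  rewrite muleC; congr (_ * _).
  rewrite (indX (iota 1 k)) ?iota_uniq//.
  by apply: eq_big_seq => i /k1 ik; rewrite /C' ik.
- apply: g_sigma_partial_sum mA => i /andP[i1 ik] C mC.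
  apply: sub_sigma_algebra.
  (* An event on one coordinate is a cylinder with no constraint on the others. *)
  exists (fun j => if j == i then C else setT) => [j|]; first by case: ifP.
  apply/seteqP; split => [w Cw j /= jk|w /(_ i) /=]; first by case: ifP => // /eqP ->.
  by rewrite eqxx; apply; rewrite mem_iota i1 add1n ltnS.
Qed.

Lemma integral_partial_sumS X k : (forall i, measurable_fun setT (X i)) ->
  mutually_independent P [set i | (1 <= i)%N] X ->
  forall h : R -> \bar R, measurable_fun setT h -> (forall x, 0 <= h x) ->
  \int[P]_w h (partial_sum X k.+1 w) =
  \int[P]_v \int[P]_w h (partial_sum X k w + X k.+1 v)%R.
Proof.
move=> mX indX h mh h0.
under eq_integral do rewrite partial_sumS.
apply: (@integral_independent_pair _ _ _ P _ _ _ _ _ _ _ _ _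
  (fun z : R * R => h (z.1 + z.2)%R)) => //.
- exact: measurable_partial_sum.
- exact: independent_partial_sum.
- apply: measurableT_comp => //; exact: measurable_funD.
Qed.

(** Induction on [j]: the last summand [X (i + j).+1] is split off, replaced by [X j.+1], which has
    the same law, and absorbed into the second partial sum. *)
Lemma integral_partial_sumD X i j : (forall i, measurable_fun setT (X i)) ->
  iid P [set i | (1 <= i)%N] X ->
  forall h : R -> \bar R, measurable_fun setT h -> (forall x, 0 <= h x) ->
  \int[P]_w h (partial_sum X (i + j) w) =
  \int[P]_v \int[P]_w h (partial_sum X i w + partial_sum X j v)%R.
Proof.
move=> mX [indX eqX]; elim: j => [|j IH] h mh h0.
  rewrite addn0.
  under [RHS]eq_integral do under eq_integral do rewrite partial_sum0 addr0.
  by rewrite integral_probability_cst.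
have mhD (a : R) : measurable_fun setT (fun x : R => h (x + a)%R).
  by apply: measurableT_comp => //; exact: measurable_funD.
have mS k := measurable_partial_sum k mX.
pose F (y : R) := \int[P]_w h (partial_sum X i w + y)%R.
have mF : measurable_fun setT F.
  apply: (@measurable_fun_fubini_tonelli_G _ _ _ _ _ P
    (fun z : T * R => h (partial_sum X i z.1 + z.2)%R)) => //.
  apply: measurableT_comp => //; apply: measurable_funD => //.
  exact: measurableT_comp.
have F0 y : 0 <= F y by exact: integral_ge0.
rewrite addnS integral_partial_sumS//.
under eq_integral => v _.
  rewrite (IH (fun x => h (x + X (i + j).+1 v)%R))//.
  under eq_integral => u _.
    under eq_integral do rewrite -addrA.
    over.
  over.
(* Only the marginal law of the outer variable matters here, since it is integrated separately from
   the partial sums. *)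
transitivity (\int[P]_v \int[P]_u F (partial_sum X j u + X j.+1 v)%R).
  apply: (@integral_equal_in_distribution _ _ _ P _ _ (X (i + j).+1) (X j.+1) _
     (fun x : R => \int[P]_u F (partial_sum X j u + x)%R)).
  - exact: eqX.
  - apply: (@measurable_fun_fubini_tonelli_G _ _ _ _ _ P
      (fun z : T * R => F (partial_sum X j z.1 + z.2)%R)) => //.
    apply: measurableT_comp => //; apply: measurable_funD => //.
    exact: measurableT_comp.
  - by move=> x; exact: integral_ge0.
by rewrite -(integral_partial_sumS _ mX indX mF F0).
Qed.

End partial_sums.

(** * Poisson weights as functions of the parameter *)

Section poisson_weight.
Context (R : realType).
Implicit Types (r a b : R) (k : nat).

(** This closed form is continuous in [r] and is also correct at [r = 0], where [0 ^+ 0 = 1] yields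
    the Dirac mass at 0. *)
Definition poisson_weight k r : R := r ^+ k / k`!%:R * expR (- r).

Lemma poisson_prob_set1 r k j : 0 <= r ->
  poisson_prob r j [set k] = (poisson_weight k r)%:E.
Proof.
rewrite /poisson_prob /poisson_weight le_eqVlt => /predU1P[<-|r0].
  rewrite ltxx diracE oppr0 expR0 mulr1 expr0n.
  case: k => [|k]; first by rewrite mem_set//= fact0 divr1.
  by rewrite memNset//= mul0r.
by rewrite r0 esum_set1 /poisson_pmf ?r0// lee_fin !mulr_ge0 ?expR_ge0// exprn_ge0// ltW.
Qed.

Lemma poisson_weight_ge0 k r : 0 <= r -> 0 <= poisson_weight k r.
Proof. by move=> r0; rewrite /poisson_weight !mulr_ge0 ?expR_ge0// exprn_ge0. Qed.

Lemma poisson_weight_le1 k r : 0 <= r -> poisson_weight k r <= 1.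
Proof.
move=> r0; rewrite -lee_fin -(@poisson_prob_set1 _ _ 0)//.
exact: (@probability_le1 _ _ _ (poisson_prob r 0)).
Qed.

Lemma continuous_poisson_weight k : continuous (poisson_weight k).
Proof.
move=> r; apply: cvgM.
  by apply: cvgM; [exact: exprn_continuous|exact: cvg_cst].
by apply: (@continuous_comp _ _ _ -%R expR); [exact: opp_continuous|exact: continuous_expR].
Qed.

Lemma measurable_poisson_weight k : measurable_fun setT (poisson_weight k).
Proof. by apply: continuous_measurable_fun; exact: continuous_poisson_weight. Qed.

(** The binomial formula for [(b + a) ^+ k], with [k!] written as a binomial coefficient times
    [i! (k - i)!]. *)
Lemma poisson_weightD k a b :
  poisson_weight k (a + b) =
  \sum_(i < k.+1) poisson_weight i a * poisson_weight (k - i) b.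
Proof.
rewrite (addrC a b) /poisson_weight exprDn opprD expRD !mulr_suml.
apply: eq_bigr => -[i /= ik] _.
have fne n : n`!%:R != 0 :> R by rewrite pnatr_eq0 -lt0n fact_gt0.
have -> : (k`!%:R : R) = 'C(k, i)%:R * (i`!%:R * (k - i)`!%:R).
  by rewrite -!natrM bin_fact.
rewrite -mulr_natr; field.
by rewrite !fne pnatr_eq0 -lt0n bin_gt0 -ltnS ik.
Qed.

End poisson_weight.

(** * A Poisson process evaluated at an independent random time *)

Section random_time.
Context (d : measure_display) (T : measurableType d) (R : realType).
Variables (P : probability T R) (D : T -> R) (N : R -> T -> nat) (lambda : R).
Hypotheses (mD : measurable_fun setT D) (D0 : forall w, 0 <= D w).
Hypothesis mN : forall t, measurable_fun setT (N t).
Hypothesis N_right_continuous :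
  forall w t, 0 <= t -> N s w @[s --> t^'+] --> N t w.
Local Open Scope ereal_scope.

Lemma measurable_nat_fun (K : T -> nat) :
  (forall k, measurable (K @^-1` [set k])) -> measurable_fun setT K.
Proof.
move=> mK _ A _; rewrite setTI.
have -> : K @^-1` A = \bigcup_(k in A) (K @^-1` [set k]).
  by apply/seteqP; split => [w Aw|w [k Ak /= ->]]; [exists (K w)|].
exact: bigcup_measurable.
Qed.

(* The approximating times are strictly larger than [D], so that right
   continuity of [N] applies, and take countably many values. *)
Let K (m : nat) (w : T) : nat := Num.truncn (m.+1%:R * D w)%R.
Let grid (m q : nat) : R := (q.+1%:R / m.+1%:R)%R.

Let grid_ge0 m q : (0 <= grid m q)%R.
Proof. by rewrite divr_ge0. Qed.

(** Each cell is an event of [D], so the independence of [N t] and [D] can be applied to it. *)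
Let K_preimage m q : exists2 B, measurable B & K m @^-1` [set q] = D @^-1` B.
Proof.
exists ((fun x : R => m.+1%:R * x)%R @^-1` `[q%:R, q.+1%:R[%classic).
  rewrite -[X in measurable X]setTI.
  have : measurable_fun setT (fun x : R => m.+1%:R * x)%R by exact: measurable_funM.
  by apply=> //; exact: measurable_itv.
apply/seteqP; split => w /=; rewrite in_itv/= -truncn_eq ?mulr_ge0//.
  by move=> <-.
by move/eqP.
Qed.

Let measurable_K m : measurable_fun setT (K m).
Proof.
apply: measurable_nat_fun => q; have [B mB ->] := K_preimage m q.
by rewrite -[X in measurable X]setTI; exact: mD.
Qed.

Let grid_gt m w : (D w < grid m (K m w))%R.
Proof. by rewrite ltr_pdivlMr// mulrC truncnS_gt. Qed.

Let grid_cvg w : grid m (K m w) @[m --> \oo] --> D w.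
Proof.
apply: (@squeeze_cvgr _ _ _ _ (fun=> D w) (fun m => D w + m.+1%:R^-1)%R).
- apply: nearW => m; rewrite (ltW (grid_gt m w))/=.
  rewrite ler_pdivrMr// mulrDl mulVf// mulrC -natr1 lerD2r.
  by have /andP[] := @truncn_itv _ (m.+1%:R * D w)%R (mulr_ge0 (ler0n _ _) (D0 w)).
- exact: cvg_cst.
- rewrite -[X in _ --> X]addr0; apply: cvgD; first exact: cvg_cst.
  exact: cvg_harmonic.
Qed.

Let N_grid w : \forall m \near \oo, N (grid m (K m w)) w = N (D w) w.
Proof.
have : \forall s \near (D w)^'+, N s w = N (D w) w.
  have NDw : N s w @[s --> (D w)^'+] --> N (D w) w by exact: N_right_continuous.
  (* The topology on [nat] is discrete: singletons are neighbourhoods, and convergence means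
     eventual equality. *)
  apply: (NDw [set N (D w) w]); exact/principal_filterP.
rewrite /at_right near_withinE => Nnear.
have [M _ NM] : \forall m \near \oo,
    (D w < grid m (K m w))%R -> N (grid m (K m w)) w = N (D w) w.
  exact: (@grid_cvg w _ Nnear).
by exists M => // m /NM; apply; exact: grid_gt.
Qed.

Let N_grid_preimage m k q :
  K m @^-1` [set q] `&` [set w | N (grid m (K m w)) w = k] =
  K m @^-1` [set q] `&` N (grid m q) @^-1` [set k].
Proof. by apply/seteqP; split => w [/= Kw]; rewrite Kw. Qed.

Let measurable_N_grid m k : measurable [set w | N (grid m (K m w)) w = k].
Proof.
have -> : [set w | N (grid m (K m w)) w = k] =
    \bigcup_q (K m @^-1` [set q] `&` [set w | N (grid m (K m w)) w = k]).
  by apply/seteqP; split => [w Nw|w [q _ []]//]; exists (K m w).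
apply: bigcupT_measurable => q; rewrite N_grid_preimage.
apply: measurableI; rewrite -[X in measurable X]setTI; [exact: measurable_K|exact: mN].
Qed.

(** By [N_grid] the event that the value is [k] is the lower limit of the events at grid times. Each
    of these is a countable union over cells on which the time is deterministic. *)
Lemma measurable_random_time : measurable_fun setT (fun w => N (D w) w).
Proof.
apply: measurable_nat_fun => k.
have -> : (fun w => N (D w) w) @^-1` [set k] =
    \bigcup_M \bigcap_(m in [set m | (M <= m)%N]) [set w | N (grid m (K m w)) w = k].
  apply/seteqP; split => w /=.
    move=> <-; have [M _ NM] := N_grid w.
    by exists M.
  move=> [M _ NM]; have [M' _ NM'] := N_grid w.
  rewrite -(NM' (maxn M M')) /= ?leq_maxr//.
  by apply: NM; rewrite /= leq_maxl.
apply: bigcupT_measurable => M; apply: bigcap_measurable; first by exists M => /=.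
by move=> m _; exact: measurable_N_grid.
Qed.

Lemma bounded_cvg_integral (f_ : nat -> T -> R) (f : T -> R) :
  (forall m, measurable_fun setT (f_ m)) -> (forall m w, (0 <= f_ m w <= 1)%R) ->
  (forall w, f_ m w @[m --> \oo] --> f w) ->
  \int[P]_w (f_ m w)%:E @[m --> \oo] --> \int[P]_w (f w)%:E.
Proof.
move=> mf f01 f_f.
apply: (@dominated_cvg _ _ _ P setT measurableT (fun m w => (f_ m w)%:E)
  (fun w => (f w)%:E) (cst 1)) => //.
- by move=> m; exact/measurable_EFinP.
- by move=> w _; apply: cvg_EFin; [exact: nearW|exact: f_f].
- exact: finite_measure_integrable_cst.
- move=> m w _; have /andP[f0 f1] := f01 m w.
  by rewrite abse_EFin lee_fin ger0_norm.
Qed.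

Hypothesis N_indep_D : forall t A B, (0 <= t)%R -> measurable A -> measurable B ->
  P (N t @^-1` A `&` D @^-1` B) = P (N t @^-1` A) * P (D @^-1` B).
Hypothesis lambda_ge0 : (0 <= lambda)%R.
Hypothesis N_poisson : forall t k, (0 <= t)%R ->
  P (N t @^-1` [set k]) = (poisson_weight k (lambda * t))%:E.

(** The formula holds at the grid times, by independence on each cell. As [m] grows, both sides
    converge by domination by 1, and the limits are identified by uniqueness. *)
Lemma random_time_poisson k :
  P ((fun w => N (D w) w) @^-1` [set k]) =
  \int[P]_w (poisson_weight k (lambda * D w))%:E.
Proof.
pose E m := [set w | N (grid m (K m w)) w = k].
pose g m w := poisson_weight k (lambda * grid m (K m w)).
have mKq m q : measurable (K m @^-1` [set q]).
  by rewrite -[X in measurable X]setTI; exact: measurable_K.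
have mg m : measurable_fun setT (g m).
  apply: (measurableT_comp (f := poisson_weight k)); first exact: measurable_poisson_weight.
  apply: measurable_funM => //.
  by apply: (measurableT_comp (f := grid m)) => //; exact: measurable_K.
have g01 m w : (0 <= g m w <= 1)%R.
  by rewrite poisson_weight_ge0 ?poisson_weight_le1// mulr_ge0.
have PE m : P (E m) = \int[P]_w (g m w)%:E.
  rewrite (probability_partition_nat P (measurable_K m) (measurable_N_grid m k)).
  rewrite (integral_partition_nat P (measurable_K m)); last 2 first.
  - exact/measurable_EFinP.
  - by move=> w; rewrite lee_fin; case/andP: (g01 m w).
  apply: eq_eseriesr => q _; rewrite N_grid_preimage setIC.
  have [B mB KB] := K_preimage m q.
  rewrite KB N_indep_D// -KB N_poisson//.
  (* On the cell [K m = q] the integrand [g m] is constant, equal to the weight at time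
     [grid m q]. *)
  rewrite -(integral_cst P (mKq m q) (poisson_weight k (lambda * grid m q))%:E).
  by apply: eq_integral => w; rewrite inE /g /= => ->.
pose E' := (fun w => N (D w) w) @^-1` [set k].
have mE' : measurable E'.
  by rewrite -[X in measurable X]setTI; exact: measurable_random_time.
have cvgE : P (E m) @[m --> \oo] --> P E'.
  have PI F : measurable F -> P F = \int[P]_w (\1_F w)%:E.
    by move=> mF; rewrite integral_indic// setIT.
  have -> : (fun m => P (E m)) = (fun m => \int[P]_w (\1_(E m) w)%:E).
    by apply/funext => m; apply: PI; exact: measurable_N_grid.
  rewrite (PI _ mE').
  apply: (@bounded_cvg_integral (fun m => \1_(E m)) \1_E').
  - by move=> m; apply: measurable_indic; exact: measurable_N_grid.
  - by move=> ? w; rewrite indicE; case: (_ \in _); rewrite /= ?lexx ler01.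
  - move=> w; apply: cvg_near_cst; have := N_grid w; apply: filterS => m Nm.
    rewrite !indicE; congr (_%:R); congr nat_of_bool.
    by apply/idP/idP; rewrite !inE /E /E' /= Nm.
have cvgg : P (E m) @[m --> \oo] --> \int[P]_w (poisson_weight k (lambda * D w))%:E.
  rewrite (funext PE).
  apply: (@bounded_cvg_integral g (fun w => poisson_weight k (lambda * D w))) => // w.
  have gridD : (lambda * grid m (K m w))%R @[m --> \oo] --> (lambda * D w)%R.
    by apply: cvgM; [exact: cvg_cst|exact: grid_cvg].
  apply: (cvg_comp (fun m => lambda * grid m (K m w))%R (poisson_weight k) gridD).
  exact: continuous_poisson_weight.
exact: (cvg_unique _ cvgE cvgg).
Qed.

End random_time.

(** * Mixed Poisson weights *)

Section poisson_mixture.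
Context (d : measure_display) (T : measurableType d) (R : realType).
Variables (P : probability T R) (lambda : R).
Hypothesis lambda_ge0 : 0 <= lambda.
Local Open Scope ereal_scope.

(* The absolute values make the integrands nonnegative on the whole line, as
   required by the transfer lemmas. *)
Let measurable_weight k : measurable_fun setT
  (fun x : R => `|poisson_weight k (lambda * x)|%:E).
Proof.
apply/measurable_EFinP; apply: measurableT_comp => //.
apply: (measurableT_comp (f := poisson_weight k)); first exact: measurable_poisson_weight.
exact: measurable_funM.
Qed.

Let weight_norm k x : (0 <= x)%R ->
  (poisson_weight k (lambda * x))%:E = `|poisson_weight k (lambda * x)|%:E.
Proof. by move=> x0; rewrite ger0_norm// poisson_weight_ge0// mulr_ge0. Qed.

Lemma poisson_mixture_equal_in_distribution k (U V : T -> R) :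
  (forall w, 0 <= U w)%R -> (forall w, 0 <= V w)%R -> equal_in_distribution P U V ->
  \int[P]_w (poisson_weight k (lambda * U w))%:E =
  \int[P]_w (poisson_weight k (lambda * V w))%:E.
Proof.
move=> U0 V0 UV; under eq_integral do rewrite weight_norm//.
under [RHS]eq_integral do rewrite weight_norm//.
apply: (integral_equal_in_distribution UV
  (h := fun x => `|poisson_weight k (lambda * x)|%:E)) => //.
Qed.

(** [poisson_weightD] is applied pointwise; independence then factors the integral of each
    product. *)
Lemma poisson_mixtureD k (U V : T -> R) :
  measurable_fun setT U -> measurable_fun setT V ->
  (forall w, 0 <= U w)%R -> (forall w, 0 <= V w)%R ->
  (forall A B, measurable A -> measurable B ->
     P (U @^-1` A `&` V @^-1` B) = P (U @^-1` A) * P (V @^-1` B)) ->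
  \int[P]_w (poisson_weight k (lambda * (U w + V w)))%:E =
  \sum_(i < k.+1) (\int[P]_w (poisson_weight i (lambda * U w))%:E *
                   \int[P]_w (poisson_weight (k - i) (lambda * V w))%:E).
Proof.
move=> mU mV U0 V0 indUV.
have mUk i : measurable_fun setT (fun w => `|poisson_weight i (lambda * U w)|%:E).
  exact: (measurableT_comp (measurable_weight i) mU).
have mVk i : measurable_fun setT (fun w => `|poisson_weight i (lambda * V w)|%:E).
  exact: (measurableT_comp (measurable_weight i) mV).
transitivity (\int[P]_w \sum_(i < k.+1)
    (`|poisson_weight i (lambda * U w)|%:E * `|poisson_weight (k - i) (lambda * V w)|%:E)).
  apply: eq_integral => w _; rewrite mulrDr poisson_weightD -sumEFin.
  by apply: eq_bigr => i _; rewrite EFinM !weight_norm.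
rewrite ge0_integral_sum//; last by move=> i; exact: emeasurable_funM.
apply: eq_bigr => i _.
rewrite (integral_independent_pair mU mV indUV (h := fun z =>
  `|poisson_weight i (lambda * z.1)|%:E * `|poisson_weight (k - i) (lambda * z.2)|%:E)).
- under eq_integral do rewrite /= ge0_integralZr//.
  rewrite ge0_integralZl//; last exact: integral_ge0.
  by congr (_ * _); apply: eq_integral => w _; rewrite weight_norm.
- apply: emeasurable_funM.
    exact: (measurableT_comp (measurable_weight i) measurable_fst).
  exact: (measurableT_comp (measurable_weight (k - i)) measurable_snd).
- by move=> z; exact: mule_ge0.
Qed.

End poisson_mixture.

(** * A sequence evaluated at an independent random index *)

Section random_index.
Context (d : measure_display) (T : measurableType d) (R : realType).
Variables (P : probability T R) (K : T -> nat) (Z : nat -> T -> R).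
Hypotheses (mK : measurable_fun setT K) (mZ : forall k, measurable_fun setT (Z k)).
Local Open Scope ereal_scope.

Lemma measurable_random_index : measurable_fun setT (fun w => Z (K w) w).
Proof.
move=> _ A mA; rewrite setTI.
have -> : (fun w => Z (K w) w) @^-1` A = \bigcup_k (K @^-1` [set k] `&` Z k @^-1` A).
  by apply/seteqP; split => [w Aw|w [k _ [/= <-]]//]; exists (K w).
apply: bigcupT_measurable => k.
by apply: measurableI; rewrite -[X in measurable X]setTI; [exact: mK|exact: mZ].
Qed.

(** Conditioning on the index: on [K = k] the integrand is [h (Z k w)], and independence takes the
    indicator of that event out of the integral. It serves both for the number of jumps and for the
    geometric counting process. *)
Lemma integral_random_index :
  (forall k A B, measurable A -> measurable B ->
     P (K @^-1` A `&` Z k @^-1` B) = P (K @^-1` A) * P (Z k @^-1` B)) ->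
  forall h : R -> \bar R, measurable_fun setT h -> (forall x, 0 <= h x) ->
  \int[P]_w h (Z (K w) w) =
  \sum_(k <oo) P (K @^-1` [set k]) * \int[P]_w h (Z k w).
Proof.
move=> indKZ h mh h0.
have mhZ k : measurable_fun setT (fun w => h (Z k w)) by exact: measurableT_comp.
rewrite (integral_partition_nat P mK)//; last first.
  by apply: measurableT_comp => //; exact: measurable_random_index.
apply: eq_eseriesr => k _.
have mKk : measurable (K @^-1` [set k]).
  by rewrite -[X in measurable X]setTI; exact: mK.
transitivity (\int[P]_(w in K @^-1` [set k]) h (Z k w)).
  by apply: eq_integral => w; rewrite inE => /= ->.
rewrite integral_mkcond.
transitivity (\int[P]_w ((\1_[set k] (K w))%:E * h (Z k w))).
  apply: eq_integral => w _; rewrite patchE indicE.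
  have -> : (w \in K @^-1` [set k]) = (K w \in [set k]) by apply/idP/idP; rewrite !inE.
  by case: ifP => _; rewrite ?mul1e ?mul0e.
rewrite (integral_independent_pair mK (mZ k) (indKZ k)
  (h := fun z => (\1_[set k] z.1)%:E * h z.2)).
- rewrite -ge0_integralZl//; apply: eq_integral => v _ /=.
  rewrite ge0_integralZr//; last first.
    apply/measurable_EFinP; apply: (measurableT_comp _ mK).
    exact: measurable_indic.
  by congr (_ * _); rewrite -[in RHS](setIT (K @^-1` _)) -integral_indic.
- apply: emeasurable_funM; last exact: (measurableT_comp mh measurable_snd).
  apply/measurable_EFinP; apply: (measurableT_comp _ measurable_fst).
  exact: measurable_indic.
- by move=> z; rewrite mule_ge0 ?lee_fin.
Qed.

End random_index.

(** Both sides sum one nonnegative family over pairs: [(i, j)] maps to [(i + j, i)], a bijection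
    from all pairs onto the triangle of pairs [(k, i)] with [i <= k]. *)
Lemma nneseries_convolution (R : realType) (p q H : nat -> \bar R) :
  (forall i, 0 <= p i)%E -> (forall i, 0 <= q i)%E -> (forall i, 0 <= H i)%E ->
  (\sum_(k <oo) ((\sum_(i < k.+1) p i * q (k - i)%N) * H k) =
   \sum_(i <oo) \sum_(j <oo) p i * (q j * H (i + j)%N))%E.
Proof.
move=> p0 q0 H0.
have pqH0 i j k : (0 <= p i * (q j * H k))%E by rewrite !mule_ge0.
pose b (z : nat * nat) := (p z.2 * (q (z.1 - z.2)%N * H z.1))%E.
transitivity (\esum_(z in setT `*`` (fun k => `I_k.+1)) b z)%E.
  rewrite -(esum_esum (a := fun k i => b (k, i))); last by move=> *; exact: pqH0.
  rewrite -nneseries_esumT; last by move=> k; apply: esum_ge0 => i _; exact: pqH0.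
  apply: eq_eseriesr => k _.
  rewrite esum_fset; [|exact: finite_II|by move=> i _; exact: pqH0].
  rewrite -fsbig_ord/= ge0_sume_distrl; last by move=> i _; exact: mule_ge0.
  by apply: eq_bigr => i _; rewrite /b/= muleA.
transitivity (\esum_(z in setT `*`` (fun=> setT)) b (z.1 + z.2, z.1)%N)%E; last first.
  rewrite nneseries_esumT; last by move=> i; exact: nneseries_ge0.
  rewrite -(esum_esum (a := fun i j => b (i + j, i)%N)); last by move=> *; exact: pqH0.
  apply: eq_esum => i _; rewrite nneseries_esumT//.
  by apply: eq_esum => j _; rewrite /b/= addKn.
rewrite (reindex_esum (setT `*`` (fun=> setT)) _ (fun z => (z.1 + z.2, z.1)%N))//.
split=> //=.
- by move=> [i j] _ /=; rewrite ltnS leq_addr.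
- by move=> [i j] [i' j'] _ _ /= [+ ii']; rewrite -ii' => /addnI ->.
- move=> [k i] [_ /=]; rewrite ltnS => ik.
  by exists (i, k - i)%N => //=; rewrite subnKC.
Qed.

(** * The convolution property of the compound sums at integer times; [M n] stands for [N^f(n)] *)

Section compound_convolution.
Context (d : measure_display) (T : measurableType d) (R : realType).
Variables (P : probability T R) (X : nat -> T -> R) (M : nat -> T -> nat).
Hypotheses (mX : forall i, measurable_fun setT (X i)).
Hypothesis X_iid : iid P [set i | (1 <= i)%N] X.
Hypothesis mM : forall n, measurable_fun setT (M n).
Hypothesis M0 : forall w, M 0%N w = 0%N.
Hypothesis MX_indep : forall n k A B, measurable A -> measurable B ->
  P (M n @^-1` A `&` partial_sum X k @^-1` B) =
  (P (M n @^-1` A) * P (partial_sum X k @^-1` B))%E.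
Hypothesis M_convolution : forall n k,
  P (M n.+1 @^-1` [set k]) =
  (\sum_(i < k.+1) P (M n @^-1` [set (i : nat)]) * P (M 1 @^-1` [set (k - i)%N]))%E.
Local Open Scope ereal_scope.

Let Y n w := partial_sum X (M n w) w.

Lemma measurable_compound n : measurable_fun setT (Y n).
Proof.
by apply: measurable_random_index => // k; exact: measurable_partial_sum.
Qed.

Lemma integral_compound n h : measurable_fun setT h -> (forall x, 0 <= h x) ->
  \int[P]_w h (Y n w) =
  \sum_(k <oo) P (M n @^-1` [set k]) * \int[P]_w h (partial_sum X k w).
Proof.
move=> mh h0; apply: integral_random_index => // [k|k A B mA mB].
  exact: measurable_partial_sum.
exact: MX_indep.
Qed.

(** Both sides expand over the numbers [i] and [j] of jumps. The convolution of the weights turns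
    the left side into a double series in [i + j], and [integral_partial_sumD] matches it with the
    right side term by term. *)
Lemma integral_compoundS n h : measurable_fun setT h -> (forall x, 0 <= h x) ->
  \int[P]_w h (Y n.+1 w) = \int[P]_v \int[P]_w h (Y n w + Y 1 v)%R.
Proof.
move=> mh h0.
have mS k := measurable_partial_sum k mX.
have mhD (c : R) : measurable_fun setT (fun x : R => h (x + c)%R).
  by apply: measurableT_comp => //; exact: measurable_funD.
pose F k (y : R) := \int[P]_w h (partial_sum X k w + y)%R.
have F0 k y : 0 <= F k y by exact: integral_ge0.
have mF k : measurable_fun setT (F k).
  apply: (@measurable_fun_fubini_tonelli_G _ _ _ _ _ P
    (fun z : T * R => h (partial_sum X k z.1 + z.2)%R)) => //.
  apply: measurableT_comp => //; apply: measurable_funD => //.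
  exact: measurableT_comp.
rewrite integral_compound//.
under eq_eseriesr do rewrite M_convolution.
rewrite (nneseries_convolution (p := fun i => P (M n @^-1` [set i]))
  (q := fun j => P (M 1 @^-1` [set j]))
  (H := fun k => \int[P]_w h (partial_sum X k w)))//; last first.
  by move=> k; exact: integral_ge0.
under [RHS]eq_integral do rewrite (@integral_compound n (fun x => h (x + _)%R))//.
rewrite integral_nneseries//; last 2 first.
- move=> k; apply: emeasurable_funM => //.
  exact: (measurableT_comp (mF k) (@measurable_compound 1)).
- by move=> k w _; rewrite mule_ge0 //; exact: F0.
apply: eq_eseriesr => i _.
transitivity (P (M n @^-1` [set i]) * \int[P]_v F i (Y 1 v)); last first.
  rewrite -ge0_integralZl//.
  exact: (measurableT_comp (mF i) (@measurable_compound 1)).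
(* The probability is made a real scalar so that it can enter the series over [j]. *)
have /fineK <- : P (M n @^-1` [set i]) \is a fin_num.
  by apply: fin_num_measure; rewrite -[X in measurable X]setTI; exact: mM.
rewrite (integral_compound 1 (mF i) (F0 i)) -nneseriesZl//; last first.
  by move=> j _; rewrite mule_ge0//; exact: integral_ge0.
by apply: eq_eseriesr => j _; rewrite integral_partial_sumD.
Qed.

(** Induction on [n]: both sides gain one independent summand with the law of [Y 1], and both vanish
    identically at [n = 0]. *)
Lemma integral_compound_partial_sum (chi : nat -> T -> R) :
  (forall i, measurable_fun setT (chi i)) ->
  mutually_independent P [set i | (1 <= i)%N] chi ->
  (forall i, (1 <= i)%N -> equal_in_distribution P (chi i) (Y 1)) ->
  forall n h, measurable_fun setT h -> (forall x, 0 <= h x) ->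
  \int[P]_w h (Y n w) = \int[P]_w h (partial_sum chi n w).
Proof.
move=> mchi chi_indep chiY; elim=> [|n IH] h mh h0.
  by apply: eq_integral => w _; rewrite /Y M0 !partial_sum0.
rewrite integral_compoundS// integral_partial_sumS//.
have mhD (c : R) : measurable_fun setT (fun x : R => h (x + c)%R).
  by apply: measurableT_comp => //; exact: measurable_funD.
under [RHS]eq_integral do rewrite -(IH (fun x => h (x + _)%R))//.
apply/esym; apply: (integral_equal_in_distribution (chiY n.+1 _)
  (h := fun x => \int[P]_w h (Y n w + x)%R)) => //; last first.
  by move=> x; exact: integral_ge0.
apply: (@measurable_fun_fubini_tonelli_G _ _ _ _ _ P
  (fun z : T * R => h (Y n z.1 + z.2)%R)) => //.
apply: measurableT_comp => //; apply: measurable_funD => //.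
by apply: measurableT_comp => //; exact: measurable_compound.
Qed.

End compound_convolution.

(** * Events belonging to the sigma-algebra of a process *)

Section process_sigma_algebra.
Context (d : measure_display) (T : measurableType d) (R : realType).

Lemma process_sigma_algebra_preimage d' (E : measurableType d') (K : Type)
    (I : set K) (X : K -> T -> E) i B :
  I i -> measurable B -> process_sigma_algebra I X (X i @^-1` B).
Proof.
move=> Ii mB; apply: sub_sigma_algebra; exists i => //.
by exists B => //; rewrite setTI.
Qed.

Lemma process_sigma_algebra_partial_sum (X : nat -> T -> R) k B :
  measurable B ->
  process_sigma_algebra [set i | (1 <= i)%N] X (partial_sum X k @^-1` B).
Proof.
move=> mB; apply: g_sigma_partial_sum => // i /andP[i1 _] C mC.
exact: process_sigma_algebra_preimage.
Qed.

End process_sigma_algebra.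

(** * One-dimensional laws of the subordinated Poisson process *)

Section subordinated_poisson.
Context (d : measure_display) (T : measurableType d) (R : realType).
Variables (P : probability T R) (D : R -> T -> R) (N : R -> T -> nat) (lambda : R).
Hypotheses (mD : forall t, measurable_fun setT (D t)).
Hypotheses (mN : forall t, measurable_fun setT (N t)).
Hypothesis lambda_ge0 : 0 <= lambda.
Hypothesis D_subordinator : subordinator P D.
Hypothesis N_poisson : poisson_process P lambda N.
Hypothesis ND_indep :
  independent_processes P [set t : R | 0 <= t] [set t : R | 0 <= t] N D.

Lemma subordinator_ge0 t w : 0 <= t -> 0 <= D t w.
Proof.
case: D_subordinator => D_levy D_nd t0.
by rewrite -(levy_start D_levy w); exact: D_nd.
Qed.

Lemma measurable_subordinated t : 0 <= t -> measurable_fun setT (subordinated N D t).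
Proof.
move=> t0; case: N_poisson => N_counting _ _.
apply: measurable_random_time => // [w|w s s0].
  exact: subordinator_ge0.
exact: counting_right_continuous N_counting w s s0.
Qed.

Lemma subordinated_poisson_prob t k : 0 <= t ->
  P (subordinated N D t @^-1` [set k]) =
  (\int[P]_w (poisson_weight k (lambda * D t w))%:E)%E.
Proof.
move=> t0; case: N_poisson => N_counting _ N_law.
apply: random_time_poisson => //.
- by move=> w; exact: subordinator_ge0.
- by move=> w s s0; exact: counting_right_continuous N_counting w s s0.
- by move=> s A B s0 mA mB; apply: ND_indep; exact: process_sigma_algebra_preimage.
- move=> s j s0; rewrite -(@poisson_prob_set1 _ _ _ 0) ?mulr_ge0//.
  (* The Poisson law is given for increments, so [N s] is read as the increment from time 0. *)
  rewrite -[in RHS](subr0 s) -N_law//; congr (P _).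
  by apply/seteqP; split => w /=; rewrite (counting_start N_counting) subn0.
Qed.

(** Splitting [D (s + t)] as [D s] plus the increment [V], independent of [D s] and distributed as
    [D t], reduces this to [poisson_mixtureD]. *)
Lemma subordinated_poisson_convolution s t k : 0 <= s -> 0 <= t ->
  P (subordinated N D (s + t) @^-1` [set k]) =
  (\sum_(i < k.+1) P (subordinated N D s @^-1` [set (i : nat)]) *
                   P (subordinated N D t @^-1` [set (k - i)%N]))%E.
Proof.
move=> s0 t0; have st0 : 0 <= s + t by exact: addr_ge0.
case: D_subordinator => D_levy D_nd.
pose V w := D (s + t) w - D s w.
have V0 w : 0 <= V w by rewrite subr_ge0 D_nd// lerDl.
rewrite subordinated_poisson_prob//.
under eq_integral => w _.
  rewrite -(subrKC (D s w) (D (s + t) w)) -/(V w).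
  over.
rewrite poisson_mixtureD//.
- apply: eq_bigr => i _; rewrite -subordinated_poisson_prob//; congr (_ * _)%E.
  rewrite subordinated_poisson_prob//.
  apply: poisson_mixture_equal_in_distribution => // [w|].
    exact: subordinator_ge0.
  exact: (levy_stationary_increments D_levy s0 t0).
- exact: measurable_funB.
- by move=> w; exact: subordinator_ge0.
- move=> A B mA mB.
  (* The times are 0, [s], [s + t], then constant: increments 0 and 1 are [D s] and [V]. *)
  pose u (i : nat) := if i is i'.+1 then (if i' is 0%N then s else s + t) else 0.
  have u_nd : nondecreasing_seq u.
    apply/nondecreasing_seqP => -[|[|i]] //=.
    by rewrite lerDl.
  have := levy_independent_increments D_levy (lexx 0 : 0 <= u 0%N) u_nd.
  move=> /(_ [:: 0%N; 1%N] (fun i => if i is 0%N then A else B)).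
  rewrite !big_cons big_nil mule1 /=.
  have -> : (fun w => D s w - D 0 w) = D s.
    by apply/funext => w; rewrite (levy_start D_levy) subr0.
  move=> <- //; last by case.
  congr (P _); apply/seteqP; split => w /=.
    by move=> [As BV] [|[|i]] //=; rewrite (levy_start D_levy) subr0.
  move=> AB; split; last by have := AB 1%N; apply.
  by have := AB 0%N isT; rewrite /= (levy_start D_levy) subr0.
Qed.

End subordinated_poisson.

(** * Conditioning on the geometric counting process *)

Theorem proposition4p3 (d : measure_display) (T : measurableType d)
  (R : realType) (P : probability T R)
  (* the subordinator D^f, its Bernstein function f and Levy measure nu *)
  (b : R) (nu : {measure set R -> \bar R}) (f : R -> R)
  (D : R -> {RV P >-> R})
  (b_ge0 : 0 <= b)
  (nu_levy : infinite_levy_measure nu)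
  (f_bernstein : bernstein_levy_khintchine b nu f)
  (D_subordinator : subordinator P (fun t => D t))
  (D_laplace : forall t s : R, 0 <= t -> 0 <= s ->
     ('E_P[fun w => expR (- s * D t w)] = (expR (- t * f s))%:E)%E)
  (* the Poisson process N and the subordinated process N^f = N o D^f *)
  (lambda : R) (N : R -> {RV P >-> nat})
  (lambda_gt0 : 0 < lambda)
  (N_poisson : poisson_process P lambda (fun t => N t))
  (N_indep_D : independent_processes P [set t : R | 0 <= t] [set t : R | 0 <= t]
     (fun t => N t) (fun t => D t))
  (* the jumps X_1, X_2, ... and Y^f ([X 0] is unused) *)
  (FX : R -> \bar R) (X : nat -> {RV P >-> R})
  (X_iid : iid P [set i | (1 <= i)%N] (fun i => X i))
  (X_cdf : forall i, (1 <= i)%N -> forall x : R, cdf (X i) x = FX x)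
  (X_indep_Nf : independent_processes P
     [set i | (1 <= i)%N] [set t : R | 0 <= t]
     (fun i => X i) (subordinated (fun t => N t) (fun t => D t)))
  (* the geometric counting process G_mu *)
  (mu : R) (G : R -> {RV P >-> nat})
  (mu_gt0 : 0 < mu)
  (G_geometric : geometric_counting_process P mu (fun t => G t))
  (G_indep_Yf : independent_processes P
     [set t : R | 0 <= t] [set t : R | 0 <= t]
     (fun t => G t)
     (compound (subordinated (fun t => N t) (fun t => D t)) (fun i => X i)))
  (* chi_0 = 0 and chi_1, chi_2, ... i.i.d. copies of Y^f(1) *)
  (chi : nat -> {RV P >-> R})
  (chi0 : forall w, chi 0%N w = 0)
  (chi_iid : iid P [set i | (1 <= i)%N] (fun i => chi i))
  (chi_dist : forall i, (1 <= i)%N ->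
     equal_in_distribution P (chi i)
       (compound (subordinated (fun t => N t) (fun t => D t))
          (fun i => X i) 1))
  (chi_indep_G : independent_processes P
     [set i | (1 <= i)%N] [set t : R | 0 <= t]
     (fun i => chi i) (fun t => G t))
  (t : R) (t_ge0 : 0 <= t) :
  equal_in_distribution P
    (time_change
       (compound (subordinated (fun t => N t) (fun t => D t)) (fun i => X i))
       (fun t => G t) t)
    (fun w => \sum_(0 <= i < (G t w).+1) chi i w).
Proof.
pose M := subordinated (fun t => N t) (fun t => D t).
have mX i : measurable_fun setT (X i) by exact: measurable_funP.
have mchi i : measurable_fun setT (chi i) by exact: measurable_funP.
have mG : measurable_fun setT (G t) by exact: measurable_funP.
have mM n : measurable_fun setT (M n%:R).
  apply: (measurable_subordinated _ _ D_subordinator N_poisson) => // s;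
    exact: measurable_funP.
have M0 w : M 0%:R w = 0%N.
  case: N_poisson => N_counting _ _; case: D_subordinator => D_levy _.
  by rewrite /M /subordinated (levy_start D_levy) (counting_start N_counting).
have MX n k A B : measurable A -> measurable B ->
    P (M n%:R @^-1` A `&` partial_sum (fun i => X i) k @^-1` B) =
    (P (M n%:R @^-1` A) * P (partial_sum (fun i => X i) k @^-1` B))%E.
  move=> mA mB; rewrite setIC muleC; apply: X_indep_Nf.
    exact: process_sigma_algebra_partial_sum.
  by apply: process_sigma_algebra_preimage => //=.
have MC n k : P (M n.+1%:R @^-1` [set k]) =
    (\sum_(i < k.+1) P (M n%:R @^-1` [set (i : nat)]) *
                     P (M 1%:R @^-1` [set (k - i)%N]))%E.
  (* The time [n.+1] is split as [n + 1], and [1%:R] is convertible to [1]. *)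
  rewrite -natr1; apply: subordinated_poisson_convolution (ltW lambda_gt0)
    D_subordinator N_poisson N_indep_D _ _ _ _ _ => // s; exact: measurable_funP.
pose Y (n : nat) := compound M (fun i => X i) n%:R.
have mY n : measurable_fun setT (Y n).
  exact: (@measurable_compound _ _ _ _ (fun n => M n%:R)).
have mS n : measurable_fun setT (partial_sum (fun i => chi i) n).
  exact: measurable_partial_sum.
(* The term of index 0 vanishes because [chi 0 = 0], leaving a partial sum that starts at 1. *)
have chiE : (fun w => \sum_(0 <= i < (G t w).+1) chi i w) =
    (fun w => partial_sum (fun i => chi i) (G t w) w).
  by apply/funext => w; rewrite big_nat_recl// chi0 add0r /partial_sum big_add1.
rewrite chiE; split.
- exact: (measurable_random_index mG mY).
- exact: (measurable_random_index mG mS).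
move=> A mA.
have PE U : measurable_fun setT U ->
    P (U @^-1` A) = (\int[P]_w (\1_A (U w))%:E)%E.
  move=> mU; rewrite -[in LHS](setIT (U @^-1` A)) -integral_indic//.
  by rewrite -[X in measurable X]setTI; exact: mU.
have m1A : measurable_fun setT (fun x : R => (\1_A x : R)%:E).
  by apply: measurableT_comp => //; exact: measurable_indic.
have A0 (x : R) : (0 <= (\1_A x : R)%:E)%E by rewrite lee_fin.
rewrite (PE _ (measurable_random_index mG mY)) (PE _ (measurable_random_index mG mS)).
rewrite (integral_random_index mG mY _ m1A A0); last first.
  move=> k B C mB mC; apply: G_indep_Yf.
    exact: process_sigma_algebra_preimage.
  by apply: process_sigma_algebra_preimage => //=.
rewrite (integral_random_index mG mS _ m1A A0); last first.
  move=> k B C mB mC; rewrite setIC muleC; apply: chi_indep_G.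
    exact: process_sigma_algebra_partial_sum.
  exact: process_sigma_algebra_preimage.
(* Both series carry the same weights [P (G t = k)], so only the laws at a fixed [k] remain to be
   compared. *)
apply: eq_eseriesr => k _; congr (_ * _)%E.
apply: (integral_compound_partial_sum mX X_iid mM M0 MX MC mchi _ _ _ m1A A0).
- by case: chi_iid.
- by move=> i i1; exact: chi_dist.
Qed.
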